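(* Assume $q^{2d}\neq1$ for all integers $d\ge1$. Then for every totally ordered index set $I$, the subalgebra $H_I^{Inv}$ of invariant elements of $H_I$ is generated by the elements $(ij)$, $i,j\in I$.
   Context: Fix $q\in\mathbb C$ with $|q|=1$, $q\neq\pm1,\pm i$, and a square root $q^{1/2}$. For a totally ordered index set $I$, $H_I$ is the unital associative $\mathbb C$-algebra generated by $x_i,y_i$ ($i\in I$) with relations $x_iy_i=qy_ix_i$ and, for $i<j$: $x_jx_i=q^2x_ix_j$, $y_jy_i=q^2y_iy_j$, $x_jy_i=qy_ix_j+(q^2-1)x_iy_j$, $y_jx_i=qx_iy_j$. The algebra $U_q(gl(2,\mathbb R))$ is generated by $E,F,K^{\pm1},L^{\pm1}$ ($L^{\pm1}$ central, $KK^{-1}=K^{-1}K=LL^{-1}=L^{-1}L=1$, $KE=qEK$, $KF=q^{-1}FK$, $EF-FE=\frac{K^2-K^{-2}}{q-q^{-1}}$) and acts on $H_I$ by $L1=K1=1$, $E1=F1=0$, $Lx_i=q^{1/2}x_i$, $Ly_i=q^{1/2}y_i$, $Kx_i=q^{-1/2}x_i$, $Ky_i=q^{1/2}y_i$, $Ex_i=q^{1/2}y_i$, $Ey_i=0$, $Fx_i=0$, $Fy_i=q^{-1/2}x_i$, extended by $K(ab)=K(a)K(b)$, $L(ab)=L(a)L(b)$, $E(ab)=E(a)K(b)+K^{-1}(a)E(b)$, $F(ab)=F(a)K(b)+K^{-1}(a)F(b)$. An element $a\in H_I$ is an invariant element of degree $k$ if $Ea=Fa=0$, $Ka=a$ and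 $La=q^{k/2}a$; $H_I^{Inv}$ is the subalgebra spanned by all invariant elements. $(ij):=q^{-1/2}x_iy_j-q^{1/2}y_ix_j$. *)

(* Defs.v *)
(* H_I is presented as the free algebra on letters x_i, y_i
   (formal linear combinations of words) modulo the two-sided ideal J generated
   by the defining relations; the U_q(gl2) action is defined on the free algebra
   by the given formulas (E(ab)=E(a)K(b)+K^{-1}(a)E(b), etc.), and all identities
   in H_I are read modulo J. *)
From HB Require Import structures.
From mathcomp Require Import all_boot all_order all_algebra.
From mathcomp Require Import reals complex.
Set Implicit Arguments. Unset Strict Implicit. Unset Printing Implicit Defensive.
Import Order.TTheory GRing.Theory Num.Theory.
Local Open Scope ring_scope.

Section HI.
Variables (R : realType) (disp : Order.disp_t) (I : orderType disp).
Local Notation C := (R[i]).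
(* q is the deformation parameter, s is the fixed square root q^{1/2} *)
Variables (q s : C).

Definition letter := (I * bool)%type.
Definition word := seq letter.
Definition X (i : I) : letter := (i, false).
Definition Y (i : I) : letter := (i, true).

Definition fpoly := seq (C * word).

Definition coef (p : fpoly) (w : word) : C :=
  \sum_(t <- p) (t.2 == w)%:R * t.1.

Definition padd (p r : fpoly) : fpoly := p ++ r.
Definition pscale (c : C) (p : fpoly) : fpoly := [seq (c * t.1, t.2) | t <- p].
Definition psub (p r : fpoly) : fpoly := padd p (pscale (-1) r).
Definition pmul (p r : fpoly) : fpoly :=
  [seq (a.1 * b.1, a.2 ++ b.2) | a <- p, b <- r].
Definition pone : fpoly := [:: (1, [::])].
Definition pword (w : word) : fpoly := [:: (1, w)].

Definition rel_xy (i : I) : fpoly :=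
  [:: (1, [:: X i; Y i]); (- q, [:: Y i; X i])].
Definition rel_xx (i j : I) : fpoly :=
  [:: (1, [:: X j; X i]); (- q ^+ 2, [:: X i; X j])].
Definition rel_yy (i j : I) : fpoly :=
  [:: (1, [:: Y j; Y i]); (- q ^+ 2, [:: Y i; Y j])].
Definition rel_xjyi (i j : I) : fpoly :=
  [:: (1, [:: X j; Y i]); (- q, [:: Y i; X j]); (- (q ^+ 2 - 1), [:: X i; Y j])].
Definition rel_yjxi (i j : I) : fpoly :=
  [:: (1, [:: Y j; X i]); (- q, [:: X i; Y j])].

Definition isRel (r : fpoly) : Prop :=
  (exists i, r = rel_xy i) \/
  (exists i j, (i < j)%O /\
     (r = rel_xx i j \/ r = rel_yy i j \/ r = rel_xjyi i j \/ r = rel_yjxi i j)).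

Inductive inJ : fpoly -> Prop :=
| J_rel (u v : word) (r : fpoly) : isRel r -> inJ (pmul (pmul (pword u) r) (pword v))
| J_add p r : inJ p -> inJ r -> inJ (padd p r)
| J_scale c p : inJ p -> inJ (pscale c p)
| J_ext p r : inJ p -> coef p =1 coef r -> inJ r.

Definition eqH (p r : fpoly) : Prop := inJ (psub p r).

Definition Klet (l : letter) : C := if l.2 then s else s^-1.
Definition Kword (w : word) : C := \prod_(l <- w) Klet l.
Definition Kop (p : fpoly) : fpoly := [seq (t.1 * Kword t.2, t.2) | t <- p].
Definition Lop (p : fpoly) : fpoly := [seq (t.1 * s ^+ size t.2, t.2) | t <- p].

Definition prepend (l : letter) (p : fpoly) : fpoly := [seq (t.1, l :: t.2) | t <- p].

(* E(l w) = E(l) K(w) + K^{-1}(l) E(w) ;  E x_i = s y_i, E y_i = 0 *)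
Fixpoint Eword (w : word) : fpoly :=
  match w with
  | [::] => [::]
  | l :: w' =>
      (if l.2 then [::] else [:: (s * Kword w', Y l.1 :: w')])
      ++ pscale (Klet l)^-1 (prepend l (Eword w'))
  end.
(* F(l w) = F(l) K(w) + K^{-1}(l) F(w) ;  F x_i = 0, F y_i = s^{-1} x_i *)
Fixpoint Fword (w : word) : fpoly :=
  match w with
  | [::] => [::]
  | l :: w' =>
      (if l.2 then [:: (s^-1 * Kword w', X l.1 :: w')] else [::])
      ++ pscale (Klet l)^-1 (prepend l (Fword w'))
  end.
Definition Eop (p : fpoly) : fpoly := flatten [seq pscale t.1 (Eword t.2) | t <- p].
Definition Fop (p : fpoly) : fpoly := flatten [seq pscale t.1 (Fword t.2) | t <- p].

Definition invariant (k : int) (p : fpoly) : Prop :=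
  eqH (Eop p) [::] /\ eqH (Fop p) [::] /\ eqH (Kop p) p /\ eqH (Lop p) (pscale (s ^ k) p).

Definition inHInv (p : fpoly) : Prop :=
  exists ps : seq (int * fpoly),
    (forall t, t \in ps -> invariant t.1 t.2) /\ eqH p (flatten (unzip2 ps)).

Definition bracket (i j : I) : fpoly :=
  [:: (s^-1, [:: X i; Y j]); (- s, [:: Y i; X j])].

Definition bracket_prod (ms : seq (I * I)) : fpoly :=
  foldr (fun ij acc => pmul (bracket ij.1 ij.2) acc) pone ms.

Definition inGenBrackets (p : fpoly) : Prop :=
  exists ts : seq (C * seq (I * I)),
    eqH p (flatten [seq pscale t.1 (bracket_prod t.2) | t <- ts]).

End HI.

(* Main.v *)
(* Let V be the two-dimensional module <x, y>. In the free algebra T, the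
   words with a given index sequence of length n span a copy of the n-th
   tensor power of V, and H_I is the quotient of T by a submodule J. Since q
   is not a root of unity, an element p of T that is invariant modulo J can be
   corrected to one that is killed by E in T itself: after projecting to
   weight zero, p - c F E p is congruent to p and is killed by a smaller power
   of E, for a suitable constant c. The weight-zero highest weight vectors in
   tensor powers of V are the linear combinations of noncrossing nestings of
   the cup s^-1 xy - s yx. Nested cups reduce to juxtaposed ones: for i < j
   the relations rewrite the (j, i)-component of a tensor as the (i,
   j)-component of its image under a combination of the identity and of the
   Temperley-Lieb operator (cup after cap), and a zigzag of such operators
   moves a cup by one position. A juxtaposition of cups is a product of
   brackets (ij). No basis of H_I is needed. *)
Require Import Defs.
From HB Require Import structures.
From mathcomp Require Import all_boot all_order all_algebra.
From mathcomp Require Import reals complex.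
From mathcomp Require Import ring boolp.
Set Implicit Arguments. Unset Strict Implicit. Unset Printing Implicit Defensive.
Import Order.TTheory GRing.Theory Num.Theory.
Local Open Scope ring_scope.

(** * Highest weight vectors in tensor powers of the two-dimensional module *)

Section QuantumTensors.
Variables (F : fieldType) (s : F).
Hypotheses (s0 : s != 0) (s_free : forall d : nat, (0 < d)%N -> s ^+ (4 * d) != 1).
Local Notation tensor := (seq bool -> F).
Implicit Types (x : F) (a c d : bool) (b : seq bool) (t u : tensor).

(** * The operators K, E and F on coefficient functions *)

Definition kl a : F := if a then s else s^-1.
Definition kw b : F := \prod_(a <- b) kl a.
Definition slice a t : tensor := fun b => t (a :: b).

(** This is E for [d = false] and F for [d = true], in transposed form: the value at [b] collects
    the coefficients of [t] at the sequences that become [b] when one letter [d] is turned into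
    [~~ d]. *)
Fixpoint raise d t b : F :=
  if b is a :: b' then
    (if a == d then 0 else kl (~~ d) * kw b' * t (d :: b'))
      + (kl a)^-1 * raise d (slice a t) b'
  else 0.

Lemma kl_neq0 a : kl a != 0. Proof. by case: a => //=; rewrite invr_eq0. Qed.

Lemma kw_cons a b : kw (a :: b) = kl a * kw b.
Proof. by rewrite /kw big_cons. Qed.

Lemma kw_neq0 b : kw b != 0.
Proof.
elim: b => [|a b IH]; first by rewrite /kw big_nil oner_eq0.
by rewrite kw_cons mulf_neq0 ?kl_neq0.
Qed.

Lemma raise_lin d x t u b :
  raise d (fun b' => x * t b' + u b') b = x * raise d t b + raise d u b.
Proof.
elim: b t u => [|a b IH] t u /=; first by rewrite mulr0 addr0.
by rewrite (IH (slice a t) (slice a u)) /slice; case: (a == d); ring.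
Qed.

Lemma raise0 d b : raise d (fun=> 0) b = 0.
Proof. by elim: b => //= a b ->; rewrite !mulr0 addr0 if_same. Qed.

Lemma raiseZ d x t b : raise d (fun b' => x * t b') b = x * raise d t b.
Proof.
have -> : (fun b' => x * t b') = (fun b' => x * t b' + 0).
  by apply/funext => b'; rewrite addr0.
by rewrite raise_lin raise0 addr0.
Qed.

(** These are the relations KE = qEK and KF = q^-1 FK, with q = s^2 and [kw] as the diagonal action
    of K. *)
Lemma raise_kw d t b :
  raise d (fun b' => kw b' * t b') b = kl d ^+ 2 * kw b * raise d t b.
Proof.
elim: b t => [|a b IH] t /=; first by rewrite !mulr0.
have -> : slice a (fun b' => kw b' * t b') =
          (fun b' => kl a * (kw b' * slice a t b')).
  by apply/funext => b'; rewrite /slice kw_cons mulrA.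
rewrite raiseZ IH !kw_cons.
by case: a; case: d {IH} => /=; field; rewrite ?s0 ?oner_neq0.
Qed.

(** * Quantum integers and the commutator of E and F *)

Definition qint (x : F) : F := (x ^+ 2 - x ^- 2) / (s ^+ 2 - s ^- 2).

Lemma sV_neq0 n : (0 < n)%N -> s ^+ (2 * n) - s ^- (2 * n) != 0.
Proof.
move=> n0; rewrite subr_eq0; apply: contra (s_free n0) => /eqP e.
by rewrite -[4%N]/(2 + 2)%N mulnDl exprD {1}e mulVf ?expf_neq0.
Qed.

Lemma qint_neq0 n : qint (s ^+ n.+1) != 0.
Proof.
rewrite mulf_neq0 ?invr_eq0 //; last exact: (@sV_neq0 1).
by rewrite -!exprM mulnC sV_neq0.
Qed.

Lemma s2V_neq0 : s ^+ 4 - 1 != 0.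
Proof. by rewrite subr_eq0 (@s_free 1). Qed.

(** Peeling off the first factor and moving K out by [raise_kw] makes the mixed terms cancel; the
    induction hypothesis and the commutator on one letter give the rest. Since [qint (s ^+ n)] is
    the quantum integer [n] for q = s^2, the right-hand side is the action of (K^2 - K^-2)/(q -
    q^-1). *)
Lemma raise_commutator t b :
  raise false (raise true t) b - raise true (raise false t) b
  = qint (kw b) * t b.
Proof.
elim: b t => [|a b IH] t.
  by rewrite /qint /kw big_nil /= !expr1n invr1 !subrr !mul0r.
have nz := s2V_neq0; have kb := kw_neq0 b.
have sl d : slice a (raise d t) = (fun b' =>
    (if a == d then 0 else kl (~~ d)) * (kw b' * t (d :: b'))
      + (kl a)^-1 * raise d (slice a t) b').
  by apply/funext => b'; rewrite /slice /=; case: (a == d); ring.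
rewrite [raise false _ _]/= [raise true (raise false _) _]/= !sl !raise_lin.
rewrite !(raise_kw _ (slice _ t)) !(raiseZ _ (kl a)^-1).
have := IH (slice a t); move: (raise false _ b) (raise true _ b) => e1 e2.
move=> /(canRL (subrK _)) ->.
rewrite /qint kw_cons /slice /=; by case: a {sl} => /=; field;
  rewrite -?expr2 -?exprM ?s0 ?nz ?kb ?oner_neq0.
Qed.

Lemma iter_raise_lin d x t u m b : iter m (raise d) (fun b' => x * t b' + u b') b
  = x * iter m (raise d) t b + iter m (raise d) u b.
Proof.
elim: m b => // m IH b; rewrite !iterS -raise_lin; congr (raise _ _ b).
exact/funext.
Qed.

(** * Supports, weights and powers of E and F *)

Lemma raise_fixed d t u b :
  (forall b', size b' = size b -> t b' = u b') -> raise d t b = raise d u b.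
Proof.
elim: b t u => //= a b IH t u e; rewrite e //; congr (_ + _ * _).
by apply: IH => b' sb'; apply: e; rewrite /= sb'.
Qed.

Lemma raise_vanish d t b :
  (forall b', size b' = size b ->
     (count_mem (~~ d) b').+1 = count_mem (~~ d) b -> t b' = 0) ->
  raise d t b = 0.
Proof.
elim: b t => //= a b IH t e.
rewrite IH => [|b' sb' cb']; last by apply: e; rewrite /= ?sb' // -cb' addnS.
rewrite mulr0 addr0; case: eqP => // ad.
have {}ad : a = ~~ d by case: a d ad {IH e} => [] [].
by rewrite e ?mulr0 //= ad eqxx; case: (d).
Qed.

Lemma iter_raise_vanish d t m b :
  (count_mem (~~ d) b < m)%N -> iter m (raise d) t b = 0.
Proof.
elim: m b => //= m IH b lt; apply: raise_vanish => b' _ cb'; apply: IH.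
by rewrite -ltnS cb'.
Qed.

Lemma iter_raise_size d t n m :
  (forall b, size b = n -> t b = 0) ->
  forall b, size b = n -> iter m (raise d) t b = 0.
Proof.
move=> t0; elim: m => //= m IH b sb.
by apply: raise_vanish => b' sb' _; apply: IH; rewrite sb'.
Qed.

(** Inverting K for [d = true] makes E and F both multiply the eigenvalue by [s ^+ 2], so one family
    of lemmas serves both. *)
Definition dkw d b := if d then (kw b)^-1 else kw b.

Lemma raise_weight d x t :
  (forall b, dkw d b * t b = x * t b) ->
  forall b, dkw d b * raise d t b = x * s ^+ 2 * raise d t b.
Proof.
move=> wt b; rewrite -[x * _]mulrC -mulrA -raiseZ.
have <- : (fun b' => dkw d b' * t b') = (fun b' => x * t b').
  by apply/funext.
have kb := kw_neq0.
case: d wt => wt /=; last first.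
  by rewrite raise_kw /=; field; rewrite s0.
rewrite -[in LHS](@raise_fixed _ (fun b' => kw b' * ((kw b')^-1 * t b'))).
  by rewrite raise_kw /=; field; rewrite kb.
by move=> b' _; rewrite mulVKf.
Qed.

Lemma iter_raise_weight d x t m :
  (forall b, dkw d b * t b = x * t b) ->
  forall b, dkw d b * iter m (raise d) t b
            = x * s ^+ (2 * m) * iter m (raise d) t b.
Proof.
move=> wt; elim: m => [|m IH] b; first by rewrite mulr1.
by rewrite /= (raise_weight IH) mulnS [(2 + _)%N]addnC exprD mulrA.
Qed.

Lemma qintV x : qint x^-1 = - qint x.
Proof. by rewrite /qint !exprVn invrK -[RHS]mulNr; congr (_ / _); ring. Qed.

Lemma raise_commutator_weight d x t b :
  (forall b, dkw d b * t b = x * t b) ->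
  raise d (raise (~~ d) t) b = raise (~~ d) (raise d t) b + qint x * t b.
Proof.
(* The eigenvalue equation determines [dkw d b] only where [t b] is nonzero; elsewhere the
   commutator term vanishes. *)
move=> wt; have [tb|tb] := eqVneq (t b) 0.
  have := raise_commutator t b; rewrite tb !mulr0 addr0 => /eqP.
  by rewrite subr_eq0; case: (d) => /= /eqP.
rewrite -(mulIf tb (wt b)); have := raise_commutator t b.
by case: (d) => /= /(canRL (subrK _)) ->; rewrite ?qintV; ring.
Qed.

(** Moving one operator through m+1 copies of the other produces the values of [qint] at x, x s^2,
    ..., x s^(2m); their sum factors as the product shown. *)
Lemma iter_raise_commutator d x t m b :
  x != 0 -> (forall b, dkw d b * t b = x * t b) ->
  iter m.+1 (raise d) (raise (~~ d) t) b
  = raise (~~ d) (iter m.+1 (raise d) t) b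
    + qint (s ^+ m.+1) * qint (x * s ^+ m) * iter m (raise d) t b.
Proof.
move=> x0 wt; elim: m b => [|m IH] b.
  rewrite /= (raise_commutator_weight _ wt) mulr1 {2}/qint expr1 divff ?mul1r //.
  exact: (@sV_neq0 1).
rewrite iterS (_ : iter m.+1 _ _ = fun b =>
  qint (s ^+ m.+1) * qint (x * s ^+ m) * iter m (raise d) t b
  + raise (~~ d) (iter m.+1 (raise d) t) b); last first.
  by apply/funext => b'; rewrite IH addrC.
rewrite raise_lin (raise_commutator_weight _ (iter_raise_weight _ wt)).
rewrite -[raise d (iter m _ _) b]/(iter m.+1 (raise d) t b).
rewrite -[raise d (iter m.+1 _ _)]/(iter m.+2 (raise d) t).
(* What remains is the quantum integer identity [qint (s ^+ m.+1) * qint (x * s ^+ m) + qint (x * s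
   ^+ (2 * m.+1)) = qint (s ^+ m.+2) * qint (x * s ^+ m.+1)]. *)
rewrite addrCA -mulrDl; congr (_ + _ * _).
have nz := s2V_neq0; have u0 : s ^+ m != 0 by rewrite expf_neq0.
rewrite /qint mulnS mul2n -addnn !exprD ![s ^+ _.+1]exprS.
by field; rewrite -!expr2 -exprM s0 nz u0 x0.
Qed.

(** If E t = 0, then E F^(m+1) t is a nonzero multiple of F^m t, so F^(m+1) t = 0 forces F^m t = 0.
    Since F^(n+1) vanishes in length [n], descent reaches t = 0. *)
Lemma highest_negative_weight n t :
  (forall b, raise false t b = 0) -> (forall b, kw b * t b = s^-1 * t b) ->
  forall b, size b = n -> t b = 0.
Proof.
move=> hw wt.
have wt' b : dkw true b * t b = s * t b.
  have [->|tb] := eqVneq (t b) 0; first by rewrite !mulr0.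
  by rewrite /= (mulIf tb (wt b)) invrK.
have down m : (forall b, size b = n -> iter m.+1 (raise true) t b = 0) ->
    forall b, size b = n -> iter m (raise true) t b = 0.
  move=> z b sb; have := iter_raise_commutator m b s0 wt'.
  rewrite raise_vanish => [|b' sb' _]; last by apply: z; rewrite sb'.
  rewrite (@iter_raise_size true (raise false t) n) // add0r -exprS => /esym/eqP.
  by rewrite mulf_eq0 (negPf (mulf_neq0 (qint_neq0 m) (qint_neq0 m))) => /eqP.
have : forall b, size b = n -> iter n.+1 (raise true) t b = 0.
  move=> b sb; apply: iter_raise_vanish.
  by rewrite ltnS -sb count_size.
by elim: n.+1 => //= m IH /down.
Qed.

(** * Cups, caps and the span of cup diagrams *)

Definition cup a c : F := if a == c then 0 else if a then - s else s^-1.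

Fixpoint ins k t b : F :=
  match k, b with
  | 0, a :: c :: b' => cup a c * t b'
  | k'.+1, a :: b' => ins k' (slice a t) b'
  | _, _ => 0
  end.

(** The scaling is chosen to fit the defining relations: for neighbouring indices in the wrong order
    they act by q^2 plus [s] times cup after cap. *)
Fixpoint cap k t b : F :=
  match k, b with
  | 0, _ => s ^+ 2 * t [:: true, false & b] - t [:: false, true & b]
  | k'.+1, a :: b' => cap k' (slice a t) b'
  | _, _ => 0
  end.

Lemma ins_lin k x t u b :
  ins k (fun b' => x * t b' + u b') b = x * ins k t b + ins k u b.
Proof.
elim: k t u b => [|k IH] t u [|a b] /=; rewrite ?mulr0 ?addr0 //.
  by case: b => [|c b]; rewrite ?mulr0 ?addr0 //; ring.
by rewrite (IH (slice a t) (slice a u)).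
Qed.

Lemma ins_zero k b : ins k (fun=> 0) b = 0.
Proof.
elim: k b => [|k IH] [|a b] //=.
by case: b => // c b; rewrite mulr0.
Qed.

Lemma ins_kw k t b : ins k (fun b' => kw b' * t b') b = kw b * ins k t b.
Proof.
elim: k t b => [|k IH] t [|a b] /=; rewrite ?mulr0 //.
  case: b => [|c b]; rewrite ?mulr0 // !kw_cons.
  by rewrite /cup; case: a; case: c => /=; field; rewrite ?s0.
rewrite (_ : slice a _ = fun b' => kl a * (kw b' * slice a t b') + 0).
  by rewrite ins_lin IH ins_zero kw_cons addr0 mulrA.
by apply/funext => b'; rewrite /slice kw_cons addr0 mulrA.
Qed.

(** The cup spans a trivial submodule: E and F kill it and K fixes it, so the coproduct passes
    through it unchanged. *)
Lemma raise_ins d k t b : raise d (ins k t) b = ins k (raise d t) b.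
Proof.
elim: k t b => [|k IH] t [|a b] //=.
  case: b => [|c b] /=; first by rewrite !mulr0 addr0; case: ifP.
  have -> : slice c (slice a (ins 0 t)) = (fun b => cup a c * t b) by [].
  rewrite raiseZ /slice /= kw_cons /cup.
  by case: a; case: c; case: d => /=; field; rewrite ?s0 ?oner_neq0.
have sl : slice a (ins k.+1 t) = ins k (slice a t) by apply/funext.
have -> : slice a (raise d t) = (fun b' =>
    (if a == d then 0 else kl (~~ d)) * (kw b' * slice d t b')
      + (kl a)^-1 * raise d (slice a t) b').
  by apply/funext => b'; rewrite /slice /=; case: (a == d); ring.
rewrite sl ins_lin ins_kw IH (_ : (fun b' => (kl a)^-1 * _) =
  fun b' => (kl a)^-1 * raise d (slice a t) b' + 0); last first.
  by apply/funext => b'; rewrite addr0.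
by rewrite ins_lin ins_zero addr0; case: (a == d); ring.
Qed.

(** A cup at [k] and a cap at [k.+1] share one strand, and the zigzag straightens to a multiple of
    the identity. *)
Lemma cap_ins k u b : (k < size b)%N -> cap k.+1 (ins k u) b = s * u b.
Proof.
elim: k u b => [|k IH] u [|a b] // lt; last exact: (IH (slice a u) b lt).
by rewrite /= /slice /cup; case: a {lt} => /=; field; rewrite ?s0.
Qed.

Lemma ins_fixed k n t u b : (forall b', size b' = n -> t b' = u b') ->
  size b = n.+2 -> ins k t b = ins k u b.
Proof.
elim: k n t u b => [|k IH] n t u [|a b] //= e [].
  by case: b => //= c b [] sb; rewrite e.
(* For [n = 0] the sequence has two letters, and a cup shifted to the right runs past its end, where
   [ins] takes its default value 0. *)
case: n e => [|n] e sb.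
  case: b sb => [|c [|]] // _.
  by case: k {IH} => [|[|k]] //=; rewrite /slice /=.
by apply: (IH n) => // b' sb'; apply: e; rewrite /= sb'.
Qed.

Lemma ins_supp k n t : (forall b, size b != n -> t b = 0) ->
  forall b, size b != n.+2 -> ins k t b = 0.
Proof.
elim: k n t => [|k IH] n t e [|a b] //=.
  by case: b => //= c b; rewrite !eqSS => /e ->; rewrite mulr0.
case: n e => [|n] e sb.
  rewrite (_ : slice a t = fun=> 0) ?ins_zero //.
  by apply/funext => b'; rewrite /slice e.
by apply: (IH n) => // b' sb'; apply: e; rewrite /= eqSS.
Qed.

(** The index [w] counts through-strands, which all carry y, and [n] is the length. A cup may be
    inserted at any position, also inside an earlier cup, which gives all noncrossing diagrams. *)
Inductive cup_span : nat -> nat -> tensor -> Prop :=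
| cup_span0 w n : cup_span w n (fun=> 0)
| cup_span_top w : cup_span w w (fun b => (b == nseq w true)%:R)
| cup_span_ins w n k t :
    (k <= n)%N -> cup_span w n t -> cup_span w n.+2 (ins k t)
| cup_span_lin w n x t u :
    cup_span w n t -> cup_span w n u ->
    cup_span w n (fun b => x * t b + u b).

Lemma cup_span_supp w n t : cup_span w n t ->
  forall b, size b != n -> t b = 0.
Proof.
elim=> {w n t} [//|w b sb|w n k t _ _ IH|w n x t u _ IHt _ IHu b sb].
- by case: (b =P nseq w true) sb => // ->; rewrite size_nseq eqxx.
- exact: ins_supp.
- by rewrite IHt // IHu // mulr0 addr0.
Qed.

Lemma cup_span_highest w n t : cup_span w n t -> forall b, raise false t b = 0.
Proof.
elim=> {w n t} [w n b|w b|w n k t _ _ IH b|w n x t u _ IHt _ IHu b].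
- exact: raise0.
- elim: b w => // a b IH [|w] /=.
    by rewrite (_ : slice _ _ = fun=> 0) // raise0 !mulr0 if_same addr0.
  rewrite !mulr0 if_same add0r; case: a.
    by rewrite (_ : slice _ _ = fun b => (b == nseq w true)%:R) // IH mulr0.
  by rewrite (_ : slice _ _ = fun=> 0) // raise0 mulr0.
- rewrite raise_ins (_ : raise _ _ = fun=> 0) ?ins_zero //; exact/funext.
- by rewrite raise_lin IHt IHu mulr0 addr0.
Qed.

Lemma cup_span_weight w n t :
  cup_span w n t -> forall b, kw b * t b = s ^+ w * t b.
Proof.
elim=> {w n t} [w n b|w b|w n k t _ _ IH b|w n x t u _ IHt _ IHu b].
- by rewrite !mulr0.
- case: eqP => [->|]; rewrite ?mulr0 // !mulr1.
  by elim: w => [|w IH]; [rewrite /kw big_nil | rewrite /= kw_cons IH exprS].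
- rewrite -ins_kw (_ : (fun b' => _) = fun b' => s ^+ w * t b' + 0).
    by rewrite ins_lin ins_zero addr0.
  by apply/funext => b'; rewrite addr0.
- by rewrite !mulrDr ![_ * (x * _)]mulrCA IHt IHu.
Qed.

(* Bend the leftmost through-strand back to the new first tensor factor. *)
Lemma cup_span_bend w n t : cup_span w.+1 n t ->
  exists2 u, cup_span w n.+1 u & slice false u = t.
Proof.
move Ew: w.+1 => w1 sp; elim: sp w Ew => {w1 n t}.
- move=> w1 n w _; exists (fun=> 0); [exact: cup_span0 | exact/funext].
- move=> _ w <-.
  (* The factor [s] cancels the coefficient [s^-1] of xy in the cup. *)
  exists (fun b => s * ins 0 (fun b => (b == nseq w true)%:R) b + 0).
    by apply: cup_span_lin; [apply/cup_span_ins/cup_span_top | apply: cup_span0].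
  apply/funext => -[|[] b]; rewrite /slice /cup /= ?mulr0 ?mul0r ?mulr0 ?addr0 //.
  by rewrite mulVKf.
- move=> w1 n k t kn _ IH w e; case: (IH w e) => u su <-.
  by exists (ins k.+1 u); [apply: cup_span_ins | apply/funext].
move=> w1 n x t u _ IHt _ IHu w e.
case: (IHt w e) => t' st <-; case: (IHu w e) => u' su <-.
by exists (fun b => x * t' b + u' b); [apply: cup_span_lin | apply/funext].
Qed.

Definition yext t : tensor := fun b => if b is true :: b' then t b' else 0.

Lemma cup_span_yext w n t : cup_span w n t -> cup_span w.+1 n.+1 (yext t).
Proof.
elim=> {w n t} [w n|w|w n k t kn _ IH|w n x t u _ IHt _ IHu].
- rewrite (_ : yext _ = fun=> 0); first exact: cup_span0.
  by apply/funext => -[|[]].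
- rewrite (_ : yext _ = fun b => (b == nseq w.+1 true)%:R).
    exact: cup_span_top.
  by apply/funext => -[|[]].
- rewrite (_ : yext _ = ins k.+1 (yext t)); first exact: cup_span_ins.
  apply/funext => -[|[] b] //=.
  by rewrite (_ : slice _ _ = fun=> 0) ?ins_zero //; apply/funext.
- rewrite (_ : yext _ = fun b => x * yext t b + yext u b).
    exact: cup_span_lin.
  by apply/funext => -[|[] b] //=; rewrite mulr0 addr0.
Qed.

(** * Highest weight vectors are combinations of cup diagrams *)

Lemma expf_neq1 n : (0 < n)%N -> s ^+ n != 1.
Proof.
move=> /s_free; apply: contra => /eqP e.
by rewrite mulnC exprM e expr1n.
Qed.

(** Induction on the length, with t = x t0 + y t1. The x-part of E t = 0 makes t0 a highest weight
    vector of weight w + 1, so t0 lies in the cup span and bends to some [u] with the same x-part.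
    The difference t - u has the form y v1 with v1 again killed by E, of weight w - 1. *)
Lemma highest_cup_span n w t :
  (forall b, size b != n -> t b = 0) -> (forall b, raise false t b = 0) ->
  (forall b, kw b * t b = s ^+ w * t b) -> cup_span w n t.
Proof.
elim: n w t => [|n IH] w t supp hw wt.
  case: w wt => [|w] wt.
    rewrite (_ : t = fun b => t [::] * (b == nseq 0 true)%:R + 0).
      by apply: cup_span_lin; [apply: cup_span_top | apply: cup_span0].
    by apply/funext => -[|a b]; rewrite ?mulr1 ?mulr0 addr0 // supp.
  rewrite (_ : t = fun=> 0); first exact: cup_span0.
  apply/funext => -[|a b]; last exact: supp.
  (* On the empty sequence K acts by 1, which differs from [s ^+ w.+1]. *)
  have /eqP := wt [::]; rewrite /kw big_nil -subr_eq0 -mulrBl mulf_eq0 subr_eq0.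
  by rewrite eq_sym (negPf (expf_neq1 _)) // => /eqP.
have wtx b : kw b * slice false t b = s ^+ w.+1 * slice false t b.
  have := wt (false :: b); rewrite kw_cons /slice /= => e.
  by apply: (mulfI (kl_neq0 false)); rewrite mulrA e /= exprS mulrA mulKf.
have /cup_span_bend [u su ut] : cup_span w.+1 n (slice false t).
  apply: IH => // b; first by move=> sb; apply: supp.
  have /eqP := hw (false :: b); rewrite /= add0r mulf_eq0 invr_eq0.
  by rewrite (negPf (kl_neq0 false)) => /eqP.
pose v b := t b - u b.
have vE : v = fun b => -1 * u b + t b by apply/funext => b; rewrite /v; ring.
have hv b : raise false v b = 0.
  by rewrite vE raise_lin hw (cup_span_highest su) mulr0 addr0.
have v0 : slice false v = fun=> 0.
  by apply/funext => b; rewrite -[LHS]/(slice false t b - slice false u b) ut subrr.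
have wv b : kw b * v b = s ^+ w * v b.
  by rewrite /v !mulrBr wt (cup_span_weight su).
have sv b : size b != n.+1 -> v b = 0.
  by move=> sb; rewrite /v supp // (cup_span_supp su) // subrr.
have hv1 b : raise false (slice true v) b = 0.
  have /eqP := hv (true :: b); rewrite /= -[v (false :: b)]/(slice false v b) v0.
  rewrite mulr0 add0r mulf_eq0 invr_eq0.
  by rewrite (negPf s0) => /eqP.
rewrite (_ : t = fun b => 1 * u b + v b); last first.
  by apply/funext => b; rewrite /v; ring.
apply: (cup_span_lin _ su).
have -> : v = yext (slice true v).
  apply/funext => -[|[] b] //=; first by rewrite sv.
  by rewrite -[LHS]/(slice false v b) v0.
case: w wt wtx su wv => [|w] wt wtx su wv; last first.
  apply/cup_span_yext/IH => // b; first by move=> sb; apply: sv.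
  have := wv (true :: b); rewrite kw_cons /= exprS -!mulrA.
  exact: (mulfI s0).
(* For w = 0 the factor after y is a highest weight vector of weight -1, hence zero. *)
rewrite (_ : yext _ = fun=> 0); first exact: cup_span0.
apply/funext => -[|[] b] //=; apply: (@highest_negative_weight (size b)) => // b'.
by apply: (mulfI s0); rewrite mulVKf // mulrA -[s * _]/(kl true * _) -kw_cons wv mul1r.
Qed.

End QuantumTensors.

(** * The quotient algebra *)

Section QuantumAlgebra.
Variables (R : realType) (disp : Order.disp_t) (I : orderType disp).
Local Notation C := (R[i]).
Local Notation poly := (fpoly R I).
Local Notation word := (word I).
Local Notation tensor := (seq bool -> C).
Variables q s : C.
Hypotheses (s0 : s != 0) (s2 : s ^+ 2 = q).
Implicit Types (p r z : poly) (w v : word) (l : letter I)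
  (ls : seq I) (x y : C) (d : bool).

(** * Formal combinations and their coefficients *)

Lemma coef_nil w : coef ([::] : poly) w = 0.
Proof. by rewrite /coef big_nil. Qed.

Lemma coef_cons x v p w :
  coef ((x, v) :: p : poly) w = (v == w)%:R * x + coef p w.
Proof. by rewrite /coef big_cons. Qed.

Lemma coef_cat p r w : coef (p ++ r) w = coef p w + coef r w.
Proof. by rewrite /coef big_cat. Qed.

Lemma coef_pscale x p w : coef (pscale x p) w = x * coef p w.
Proof.
rewrite /coef big_map mulr_sumr; apply: eq_bigr => t _ /=; ring.
Qed.

Lemma coef_psub p r w : coef (psub p r) w = coef p w - coef r w.
Proof. by rewrite coef_cat coef_pscale mulN1r. Qed.

Lemma coef_prepend l p w :
  coef (prepend l p) w = if w is a :: w' then (l == a)%:R * coef p w' else 0.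
Proof.
rewrite /coef big_map; case: w => [|a w].
  by rewrite big1 // => t _; rewrite mul0r.
rewrite mulr_sumr; apply: eq_bigr => t _ /=.
by rewrite eqseq_cons -mulnb natrM mulrA.
Qed.

Definition peval (g : word -> C) p := \sum_(t <- p) t.1 * g t.2.

Lemma pevalE g p (W : seq word) :
  uniq W -> {subset [seq t.2 | t <- p] <= W} ->
  peval g p = \sum_(w <- W) coef p w * g w.
Proof.
move=> uW sub; under eq_bigr do rewrite /coef mulr_suml.
rewrite exchange_big /=; apply: eq_big_seq => t tp.
have tW : t.2 \in W by apply/sub/map_f.
rewrite (bigD1_seq t.2) //= eqxx mul1r big1 ?addr0 // => w.
by rewrite eq_sym => /negPf ->; rewrite !mul0r.
Qed.

(** A formal combination may list a word several times; regrouping both sums over one duplicate-free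
    list of words leaves only the coefficients. *)
Lemma peval_ext g p r : coef p =1 coef r -> peval g p = peval g r.
Proof.
move=> e; pose W := undup ([seq t.2 | t <- p] ++ [seq t.2 | t <- r]).
rewrite !(@pevalE _ _ W) ?undup_uniq //.
- by under eq_bigr do rewrite e.
- by move=> w; rewrite mem_undup mem_cat orbC => ->.
- by move=> w; rewrite mem_undup mem_cat => ->.
Qed.

Lemma coef_map (f : word -> word) p w :
  coef [seq (t.1, f t.2) | t <- p] w = peval (fun v => (f v == w)%:R) p.
Proof. by rewrite /coef big_map; apply: eq_bigr => t _; rewrite mulrC. Qed.

Definition lin (f : word -> poly) p : poly :=
  flatten [seq pscale t.1 (f t.2) | t <- p].

Lemma coef_lin f p w : coef (lin f p) w = peval (fun v => coef (f v) w) p.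
Proof.
elim: p => [|t p IH]; first by rewrite coef_nil /peval big_nil.
by rewrite /lin /= coef_cat coef_pscale -/(lin f p) IH /peval big_cons.
Qed.

Lemma lin_cat f p r : lin f (p ++ r) = lin f p ++ lin f r.
Proof. by rewrite /lin map_cat flatten_cat. Qed.

Lemma coef_lin_pscale f x p w : coef (lin f (pscale x p)) w = x * coef (lin f p) w.
Proof.
rewrite !coef_lin /peval big_map mulr_sumr.
by apply: eq_bigr => t _ /=; rewrite mulrA.
Qed.

Definition torus (f : word -> C) p : poly := [seq (t.1 * f t.2, t.2) | t <- p].

Lemma coef_torus f p w : coef (torus f p) w = f w * coef p w.
Proof.
rewrite /coef big_map mulr_sumr; apply: eq_bigr => t _ /=.
by case: eqP => [->|_]; [ring | rewrite !mul0r mulr0].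
Qed.

Lemma coef_Kop p w : coef (Kop s p) w = Kword s w * coef p w.
Proof. exact: coef_torus. Qed.

(** * Closure properties of the ideal J *)

Local Notation inJ := (@inJ R disp I q).
Local Notation eqH := (@eqH R disp I q).

(* There is no relation at all when I is empty, and then inJ is empty too. *)
Lemma inJ_nil p : inJ p -> inJ [::].
Proof.
move=> Jp; apply: (J_ext (J_scale 0 Jp)) => w.
by rewrite coef_pscale mul0r coef_nil.
Qed.

Lemma inJ_lin x y p r z : inJ p -> inJ r ->
  (forall w, coef z w = x * coef p w + y * coef r w) -> inJ z.
Proof.
move=> Jp Jr e; apply: (J_ext (J_add (J_scale x Jp) (J_scale y Jr))) => w.
by rewrite coef_cat !coef_pscale e.
Qed.

Lemma genE u r v : pmul (pmul (pword R u) r) (pword R v)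
  = [seq (t.1, u ++ t.2 ++ v) | t <- r] :> poly.
Proof.
rewrite /pmul /pword /= cats0 flatten_map1 -map_comp.
by apply: eq_map => t /=; rewrite mul1r mulr1 catA.
Qed.

Lemma inJ_prepend l p : inJ p -> inJ (prepend l p).
Proof.
elim=> {p} [u v r rel|p r _ IHp _ IHr|x p _ IH|p r _ IH e].
- rewrite (_ : prepend l _ = pmul (pmul (pword R (l :: u)) r) (pword R v)).
    exact: J_rel.
  by rewrite !genE /prepend -map_comp.
- by rewrite /padd /prepend map_cat; apply: J_add.
- apply: (J_ext (J_scale x IH)) => -[|a w].
    by rewrite coef_pscale !coef_prepend mulr0.
  by rewrite coef_pscale !coef_prepend coef_pscale; ring.
- by apply: (J_ext IH) => -[|a w]; rewrite !coef_prepend // e.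
Qed.

Definition postpend l p : poly := [seq (t.1, rcons t.2 l) | t <- p].

Lemma inJ_postpend l p : inJ p -> inJ (postpend l p).
Proof.
elim=> {p} [u v r rel|p r _ IHp _ IHr|x p _ IH|p r _ IH e].
- rewrite (_ : postpend l _ = pmul (pmul (pword R u) r) (pword R (rcons v l))).
    exact: J_rel.
  rewrite !genE /postpend -map_comp; apply: eq_map => t /=.
  by rewrite !rcons_cat.
- by rewrite /padd /postpend map_cat; apply: J_add.
- apply: (J_ext (J_scale x IH)) => w; congr coef.
  by rewrite /pscale /postpend -!map_comp.
- by apply: (J_ext IH) => w; rewrite !(coef_map (rcons^~ l)); apply: peval_ext.
Qed.

(** * Stability of J under K, E and F *)

Lemma Kword_cons l w : Kword s (l :: w) = Klet s l * Kword s w.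
Proof. by rewrite /Kword big_cons. Qed.

Lemma Kword_cat w v : Kword s (w ++ v) = Kword s w * Kword s v.
Proof. by rewrite /Kword big_cat. Qed.

Lemma rel_weight r : isRel q r ->
  exists x, forall t, t \in r -> Kword s t.2 = x.
Proof.
have k2 l l' : Kword s [:: l; l'] = Klet s l * Klet s l'.
  by rewrite !Kword_cons /Kword big_nil mulr1.
case=> [[i ->]|[i [j [_ [|[|[|]]] ->]]]].
- by exists (s^-1 * s) => t; rewrite !inE => /orP [] /eqP -> /=; rewrite k2 // mulrC.
- by exists (s^-1 * s^-1) => t; rewrite !inE => /orP [] /eqP -> /=; rewrite k2.
- by exists (s * s) => t; rewrite !inE => /orP [] /eqP -> /=; rewrite k2.
- exists (s^-1 * s) => t; rewrite !inE => /or3P [] /eqP -> /=; rewrite k2 //.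
  by rewrite mulrC.
- by exists (s^-1 * s) => t; rewrite !inE => /orP [] /eqP -> /=; rewrite k2 // mulrC.
Qed.

(** Every relation is homogeneous for K, so each generator of J is only rescaled. The identity gives
    K, and inversion gives K^-1. *)
Lemma inJ_torus (h : C -> C) p :
  {morph h : x y / x * y} -> inJ p -> inJ (torus (h \o Kword s) p).
Proof.
move=> hM; elim=> {p} [u v r rel|p r _ IHp _ IHr|x p _ IH|p r _ IH e].
- have [x rx] := rel_weight rel.
  rewrite (_ : torus _ _ = pscale (h (Kword s u * (x * Kword s v)))
    (pmul (pmul (pword R u) r) (pword R v))); first exact/J_scale/J_rel.
  rewrite !genE /torus /pscale -!map_comp; apply/eq_in_map => t tr /=.
  by rewrite !Kword_cat (rx t tr) mulrC.
- by rewrite /padd /torus map_cat; apply: J_add.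
- apply: (J_ext (J_scale x IH)) => w.
  by rewrite coef_pscale !coef_torus coef_pscale; ring.
- by apply: (J_ext IH) => w; rewrite !coef_torus e.
Qed.

Lemma inJ_Kop p : inJ p -> inJ (Kop s p).
Proof. exact: (@inJ_torus id). Qed.

Lemma inJ_Kinv p : inJ p -> inJ (torus (fun w => (Kword s w)^-1) p).
Proof. by apply: (@inJ_torus GRing.inv) => x y; rewrite invfM. Qed.

(* Eword is the case d = false, Fword the case d = true. *)
Fixpoint Dword d w : poly :=
  if w is l :: w' then
    (if l.2 == d then [:: (kl s (~~ d) * Kword s w', (l.1, ~~ d) :: w')] else [::])
      ++ pscale (Klet s l)^-1 (prepend l (Dword d w'))
  else [::].

Local Notation Dop d := (lin (Dword d)).

Lemma EopE p : Eop s p = Dop false p.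
Proof.
rewrite /Eop /lin; congr flatten; apply: eq_map => t; congr pscale.
by elim: t.2 => //= -[i []] w ->.
Qed.

Lemma FopE p : Fop s p = Dop true p.
Proof.
rewrite /Fop /lin; congr flatten; apply: eq_map => t; congr pscale.
by elim: t.2 => //= -[i []] w ->.
Qed.

Lemma coef_Dop_prepend d l p w : coef (Dop d (prepend l p)) w =
  (if l.2 == d then kl s (~~ d) else 0) * coef (prepend (l.1, ~~ d) (Kop s p)) w
  + (Klet s l)^-1 * coef (prepend l (Dop d p)) w.
Proof.
elim: p => [|[x v] p IH]; first by rewrite /lin /= !coef_nil !mulr0 addr0.
have -> : Dop d ((x, v) :: p) = pscale x (Dword d v) ++ Dop d p by [].
have -> : Dop d (prepend l ((x, v) :: p)) =
  pscale x (Dword d (l :: v)) ++ Dop d (prepend l p) by [].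
have -> : prepend (l.1, ~~ d) (Kop s ((x, v) :: p)) =
  (x * Kword s v, (l.1, ~~ d) :: v) :: prepend (l.1, ~~ d) (Kop s p) by [].
have -> r r' : prepend l (r ++ r') = prepend l r ++ prepend l r'.
  exact: map_cat.
rewrite !coef_cat coef_cons IH !coef_pscale /= coef_cat.
rewrite coef_pscale (_ : coef (prepend l (pscale _ _)) w =
  x * coef (prepend l (Dword d v)) w); last first.
  by rewrite !coef_prepend; case: w {IH} => [|a w]; rewrite ?mulr0 // coef_pscale; ring.
by case: (l.2 == d); rewrite ?coef_cons coef_nil; ring.
Qed.

(** This is coassociativity: the action, defined by splitting off the first letter, obeys the same
    coproduct formula at the last letter. *)
Lemma Dword_rcons d w l : Dword d (rcons w l) =
  [seq (t.1 * Klet s l, rcons t.2 l) | t <- Dword d w] ++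
  (if l.2 == d then [:: ((Kword s w)^-1 * kl s (~~ d), rcons w (l.1, ~~ d))]
   else [::]).
Proof.
elim: w => [|a w IH] /=.
  by rewrite /Kword big_nil mulr1 invr1 mul1r cats0.
rewrite IH /prepend /pscale !map_cat -!map_comp -catA; congr (_ ++ _).
  by case: (a.2 == d) => //=; rewrite -cats1 Kword_cat /Kword big_seq1 mulrA.
congr (_ ++ _); first by apply: eq_map => t /=; rewrite mulrA.
by case: (l.2 == d) => //=; rewrite Kword_cons invfM mulrA.
Qed.

Lemma coef_Dop_postpend d l p w : coef (Dop d (postpend l p)) w =
  Klet s l * coef (postpend l (Dop d p)) w +
  (if l.2 == d then kl s (~~ d) else 0) *
  coef (postpend (l.1, ~~ d) (torus (fun w => (Kword s w)^-1) p)) w.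
Proof.
elim: p => [|[x v] p IH]; first by rewrite /lin /= !coef_nil !mulr0 addr0.
have -> : Dop d ((x, v) :: p) = pscale x (Dword d v) ++ Dop d p by [].
have -> : Dop d (postpend l ((x, v) :: p)) =
  pscale x (Dword d (rcons v l)) ++ Dop d (postpend l p) by [].
have -> : postpend (l.1, ~~ d) (torus (fun w => (Kword s w)^-1) ((x, v) :: p)) =
  (x * (Kword s v)^-1, rcons v (l.1, ~~ d)) ::
  postpend (l.1, ~~ d) (torus (fun w => (Kword s w)^-1) p) by [].
have -> r r' : postpend l (r ++ r') = postpend l r ++ postpend l r'.
  exact: map_cat.
rewrite !coef_cat coef_cons IH !coef_pscale.
rewrite Dword_rcons coef_cat.
have -> : [seq (t.1 * Klet s l, rcons t.2 l) | t <- Dword d v]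
          = pscale (Klet s l) (postpend l (Dword d v)).
  by rewrite /pscale -map_comp; apply: eq_map => t; rewrite /= mulrC.
have -> : postpend l (pscale x (Dword d v)) = pscale x (postpend l (Dword d v)).
  by rewrite /pscale /postpend -!map_comp.
by rewrite !coef_pscale; case: (l.2 == d); rewrite ?coef_cons coef_nil; ring.
Qed.

Lemma inJ_isRel r : isRel q r -> inJ r.
Proof.
move=> rel; have := J_rel [::] [::] rel; rewrite genE.
rewrite (_ : [seq _ | _ <- r] = r) //.
by rewrite -[RHS]map_id; apply: eq_map => -[x w] /=; rewrite cats0.
Qed.

Lemma inJ_Dop_rel d r : isRel q r -> inJ (Dop d r).
Proof.
move=> rel; have Jnil := inJ_nil (inJ_isRel rel).
case: rel => [[i ->]|[i [j [ij e]]]].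
  (* E and F kill x_i y_i - q y_i x_i already in the free algebra. *)
  apply: (J_ext Jnil) => w; rewrite coef_nil /lin.
  by case: d; rewrite /= /Kword ?big_seq1 ?big_nil !coef_cons coef_nil /Klet /= -?s2;
    field; rewrite ?s0 ?oner_neq0.
have [Rxx Ryy Rxy Ryx] : [/\ inJ (rel_xx q i j), inJ (rel_yy q i j),
    inJ (rel_xjyi q i j) & inJ (rel_yjxi q i j)].
  by split; apply: inJ_isRel; right; exists i, j; split=> //; tauto.
have [x [p [y [p' [Jp [Jp' cE]]]]]] : exists x p y p', inJ p /\ inJ p' /\
    forall w, coef (Dop d r) w = x * coef p w + y * coef p' w.
  (* The first four witnesses are for F, the last four for E, each on the relations xx, yy, x_j y_i,
     y_j x_i in turn. *)
  case: d e => [] [|[|[|]]] ->;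
    [exists 0, [::], 0, [::]
    |exists 1, (rel_xjyi q i j), q^-1, (rel_yjxi q i j)
    |exists 1, (rel_xx q i j), 0, [::]
    |exists q^-1, (rel_xx q i j), 0, [::]
    |exists 1, (rel_yjxi q i j), q, (rel_xjyi q i j)
    |exists 0, [::], 0, [::]
    |exists q, (rel_yy q i j), 0, [::]
    |exists 1, (rel_yy q i j), 0, [::]]; do 2!split=> //; move=> w;
    rewrite /lin /= /Kword ?big_seq1 ?big_nil ?coef_cons ?coef_nil /Klet /= -?s2;
    by field; rewrite ?s0 ?oner_neq0.
exact: inJ_lin Jp Jp' cE.
Qed.

(** On a generator u r v, the letters of u are peeled off from the left and those of v from the
    right. Each peeling leaves one term with K or K^-1 applied to a shorter generator, and the end
    of the recursion is the relation itself. *)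
Lemma inJ_Dop d p : inJ p -> inJ (Dop d p).
Proof.
elim=> {p} [u v r rel|p r _ IHp _ IHr|x p _ IH|p r _ IH e].
- elim: u => [|l u IH].
    elim/last_ind: v => [|v l IH].
      rewrite genE (_ : [seq _ | _ <- r] = r); first exact: inJ_Dop_rel.
      by rewrite -[RHS]map_id; apply: eq_map => -[x w] /=; rewrite cats0.
    have -> : pmul (pmul (pword R [::]) r) (pword R (rcons v l))
        = postpend l (pmul (pmul (pword R [::]) r) (pword R v)).
      rewrite !genE /postpend -map_comp; apply: eq_map => t /=.
      by rewrite rcons_cat.
    apply: inJ_lin (inJ_postpend l IH) _ (coef_Dop_postpend _ _ _).
    exact/inJ_postpend/inJ_Kinv/J_rel.
  have -> : pmul (pmul (pword R (l :: u)) r) (pword R v)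
      = prepend l (pmul (pmul (pword R u) r) (pword R v)).
    by rewrite !genE /prepend -map_comp.
  apply: inJ_lin _ (inJ_prepend l IH) (coef_Dop_prepend _ _ _).
  exact/inJ_prepend/inJ_Kop/J_rel.
- by rewrite lin_cat; apply: J_add.
- by apply: (J_ext (J_scale x IH)) => w; rewrite coef_pscale coef_lin_pscale.
- by apply: (J_ext IH) => w; rewrite !coef_lin; apply: peval_ext.
Qed.

(** * Components along index sequences *)

Lemma Kword_unzip w : Kword s w = kw s (unzip2 w).
Proof. by rewrite /kw big_map. Qed.

(** E and F exchange x and y but keep the indices, so they act on each index sequence separately, as
    on a tensor power. *)
Lemma coef_Dword d v w : coef (Dword d v) w =
  raise s d (fun b => (v == zip (unzip1 w) b)%:R) (unzip2 w).
Proof.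
elim: w v => [|[i a] w IH] [|[j c] v].
- by rewrite coef_nil.
- by rewrite /= coef_cat coef_pscale coef_prepend mulr0 addr0; case: ifP => _;
    rewrite ?coef_cons coef_nil ?mul0r ?addr0.
- rewrite /= coef_nil (_ : slice a _ = fun=> 0) // raise0 !mulr0 if_same addr0 //.
rewrite /= (_ : slice a _ =
    fun b => ((j, c) == (i, a))%:R * (v == zip (unzip1 w) b)%:R); last first.
  by apply/funext => b; rewrite /slice /= eqseq_cons -mulnb natrM.
rewrite raiseZ -IH coef_cat coef_pscale coef_prepend zip_unzip -Kword_unzip.
rewrite eqseq_cons !xpair_eqE.
set e := coef _ w; have -> : coef (if c == d then
    [:: (kl s (~~ d) * Kword s v, (j, ~~ d) :: v)] else [::]) ((i, a) :: w)
  = (if c == d then kl s (~~ d) * Kword s w else 0) *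
    ((j == i) && (~~ d == a) && (v == w))%:R.
  case: (c == d); last by rewrite coef_nil mul0r.
  rewrite coef_cons coef_nil addr0 eqseq_cons xpair_eqE mulrC.
  by case: (v =P w) => [->|] //; rewrite !andbF !mulr0.
case: (j == i); case: (v == w); case: a; case: c; case: d {IH} @e => e /=;
  rewrite /Klet /=; ring.
Qed.

Lemma coef_Dop d p w : coef (Dop d p) w =
  raise s d (fun b => coef p (zip (unzip1 w) b)) (unzip2 w).
Proof.
rewrite coef_lin; elim: p => [|[x v] p IH].
  rewrite /peval big_nil -[LHS](raise0 s d (unzip2 w)).
  by apply: raise_fixed => b _; rewrite coef_nil.
rewrite /peval big_cons -/(peval (fun v => coef (Dword d v) w) p) IH /=.
rewrite coef_Dword -raise_lin.
by apply: raise_fixed => b _; rewrite coef_cons mulrC.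
Qed.

(* The tensor of the component of p on the words with index sequence ls. *)
Definition comp p ls : tensor :=
  fun b => if size b == size ls then coef p (zip ls b) else 0.

Lemma comp_size p ls b : size b != size ls -> comp p ls b = 0.
Proof. by rewrite /comp => /negPf ->. Qed.

Lemma comp_Dop d p ls : comp (Dop d p) ls = raise s d (comp p ls).
Proof.
apply/funext => b; have [sb|sb] := eqVneq (size b) (size ls); last first.
  rewrite comp_size // raise_vanish // => b' sb' _.
  by rewrite comp_size // sb'.
rewrite /comp sb eqxx coef_Dop unzip1_zip ?unzip2_zip ?sb //.
by apply: raise_fixed => b' ->; rewrite sb eqxx.
Qed.

Lemma comp_weight x p ls : (forall w, Kword s w * coef p w = x * coef p w) ->
  forall b, kw s b * comp p ls b = x * comp p ls b.
Proof.
move=> wt b; rewrite /comp; case: eqP => sb; last by rewrite !mulr0.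
by rewrite -wt Kword_unzip unzip2_zip ?sb.
Qed.

Fixpoint tens ls (t : tensor) : poly :=
  if ls is i :: ls' then
    prepend (X i) (tens ls' (slice false t)) ++ prepend (Y i) (tens ls' (slice true t))
  else [:: (t [::], [::])].

Lemma coef_tens ls t w :
  coef (tens ls t) w = if unzip1 w == ls then t (unzip2 w) else 0.
Proof.
elim: ls t w => [|i ls IH] t [|[j a] w] /=.
- by rewrite coef_cons coef_nil mul1r addr0.
- by rewrite coef_cons coef_nil mul0r addr0.
- by rewrite coef_cat !coef_prepend addr0.
rewrite coef_cat !coef_prepend !IH /slice eqseq_cons !xpair_eqE [j == i]eq_sym.
by case: (i == j); case: (_ == ls); case: a => /=;
  rewrite ?mul1r ?mul0r ?mulr0 ?addr0 ?add0r.
Qed.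

Lemma tens_comp_sum p : exists U : seq (seq I),
  forall w, coef p w = coef (flatten [seq tens ls (comp p ls) | ls <- U]) w.
Proof.
(* Each index sequence must occur once, since [comp] already gathers all words that carry it. *)
pose U := undup [seq unzip1 t.2 | t <- p]; exists U => w.
have -> : coef (flatten [seq tens ls (comp p ls) | ls <- U]) w =
    \sum_(ls <- U) (if unzip1 w == ls then coef p w else 0).
  elim: U => [|ls U IH]; first by rewrite big_nil coef_nil.
  rewrite /= coef_cat IH big_cons coef_tens; congr (_ + _).
  by case: eqP => // <-; rewrite /comp !size_map eqxx zip_unzip.
have [wU|wU] := boolP (unzip1 w \in U).
  rewrite (bigD1_seq (unzip1 w)) ?undup_uniq //= eqxx big1 ?addr0 // => ls.
  by rewrite eq_sym => /negPf ->.
rewrite big1_seq => [|ls /= lsU]; last first.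
  by case: eqP => // e; rewrite e lsU in wU.
rewrite /coef big1_seq // => t /= tp; case: eqP => [e|]; last by rewrite mul0r.
by case/negP: wU; rewrite mem_undup -e (map_f (fun x : C * word => unzip1 x.2)).
Qed.

(** * Linear combinations of bracket products *)

Local Notation inGen := (@inGenBrackets R disp I q s).

Lemma eqH_lin x y p p' r r' z z' : eqH p p' -> eqH r r' ->
  (forall w, coef z w = x * coef p w + y * coef r w) ->
  (forall w, coef z' w = x * coef p' w + y * coef r' w) -> eqH z z'.
Proof.
move=> Jp Jr e e'; apply: (inJ_lin (x := x) (y := y) Jp Jr) => w.
by rewrite !coef_psub e e'; ring.
Qed.

Lemma eqH_coef p r z : inJ z -> coef p =1 coef r -> eqH p r.
Proof.
move=> /inJ_nil Jz e; apply: (J_ext Jz) => w.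
by rewrite coef_psub e subrr coef_nil.
Qed.

Lemma eqH_inJ p : eqH p [::] <-> inJ p.
Proof.
by split=> J; apply: (J_ext J) => w; rewrite coef_psub coef_nil subr0.
Qed.

Lemma eqH_trans p r z : eqH p r -> eqH r z -> eqH p z.
Proof.
by move=> J J'; apply: (J_ext (J_add J J')) => w;
  rewrite coef_cat !coef_psub; ring.
Qed.

Lemma inGen_eqH p r : eqH p r -> inGen r -> inGen p.
Proof. by move=> e [ts Jts]; exists ts; apply: eqH_trans Jts. Qed.

Lemma inGen_inJ p : inJ p -> inGen p.
Proof. by move=> /eqH_inJ Jp; exists [::]. Qed.

Lemma inGen_lin x y p r z : inGen p -> inGen r ->
  (forall w, coef z w = x * coef p w + y * coef r w) -> inGen z.
Proof.
move=> [ts Jts] [us Jus] e.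
exists ([seq (x * c.1, c.2) | c <- ts] ++ [seq (y * c.1, c.2) | c <- us]).
apply: (eqH_lin (x := x) (y := y) Jts Jus e) => w.
rewrite map_cat flatten_cat coef_cat.
have sc a (vs : seq (C * seq (I * I))) : coef (flatten
    [seq pscale t.1 (bracket_prod s t.2) | t <- [seq (a * c.1, c.2) | c <- vs]]) w
    = a * coef (flatten [seq pscale t.1 (bracket_prod s t.2) | t <- vs]) w.
  elim: vs => [|c vs IH]; first by rewrite coef_nil mulr0.
  by rewrite /= !coef_cat IH !coef_pscale; ring.
by rewrite !sc.
Qed.

Lemma inGen_coef p r : inGen r -> coef p =1 coef r -> inGen p.
Proof.
by move=> Gr e; apply: (inGen_lin (x := 1) (y := 0) Gr Gr) => w; rewrite e; ring.
Qed.

Lemma inGen_pone : inJ [::] -> inGen (pone R I).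
Proof.
move=> J; exists [:: (1, [::])]; apply: (eqH_coef J) => w.
by rewrite /= mulr1.
Qed.

Lemma coef_bracket_mul i j p w : coef (pmul (bracket s i j) p) w =
  s^-1 * coef (prepend (X i) (prepend (Y j) p)) w
  - s * coef (prepend (Y i) (prepend (X j) p)) w.
Proof.
have -> : pmul (bracket s i j) p = pscale s^-1 (prepend (X i) (prepend (Y j) p))
    ++ pscale (- s) (prepend (Y i) (prepend (X j) p)).
  by rewrite /pmul /bracket /= cats0 /pscale /prepend -!map_comp.
by rewrite coef_cat !coef_pscale mulNr.
Qed.

Lemma inGen_bracket i j p : inGen p -> inGen (pmul (bracket s i j) p).
Proof.
case=> ts Jts; exists [seq (c.1, (i, j) :: c.2) | c <- ts].
set B := flatten _ in Jts *.
have JB : eqH (pmul (bracket s i j) p) (pmul (bracket s i j)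
    (flatten [seq pscale t.1 (bracket_prod s t.2) | t <- ts])).
  have pr l p' r' : eqH p' r' -> eqH (prepend l p') (prepend l r').
    move=> /(inJ_prepend l) J; apply: (J_ext J) => -[|a w];
    by rewrite coef_psub !coef_prepend ?subrr // coef_psub; ring.
  by apply: (eqH_lin (x := s^-1) (y := - s) (pr (X i) _ _ (pr (Y j) _ _ Jts))
    (pr (Y i) _ _ (pr (X j) _ _ Jts))) => w; rewrite coef_bracket_mul mulNr.
apply: eqH_trans JB _; apply: (eqH_coef Jts) => w; rewrite /B.
elim: ts {B Jts} => [|c ts IH].
  by rewrite coef_bracket_mul /prepend /= !coef_nil !mulr0 subrr.
rewrite coef_bracket_mul /= [RHS]coef_cat -IH coef_pscale !coef_bracket_mul !coef_prepend.
by case: w {IH} => [|a [|b w]]; rewrite ?coef_prepend ?coef_cat ?coef_pscale; ring.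
Qed.

Lemma inGen_flatten (ps : seq poly) : inJ [::] ->
  (forall p, p \in ps -> inGen p) -> inGen (flatten ps).
Proof.
move=> J; elim: ps => [|p ps IH] G; first exact: inGen_inJ.
apply: (inGen_lin (x := 1) (y := 1) (G p (mem_head _ _)) (IH _)) => [r rp|w].
  by apply: G; rewrite inE rp orbT.
by rewrite /= coef_cat !mul1r.
Qed.

(** * The defining relations as operators on tensors *)

Lemma coef_rel_mul (r : poly) p w : coef (pmul r p) w =
  \sum_(t <- r) t.1 * coef (foldr (@prepend R disp I) p t.2) w.
Proof.
elim: r => [|[x v] r IH]; first by rewrite big_nil coef_nil.
rewrite big_cons -IH -coef_pscale -coef_cat; congr coef; congr (_ ++ _).
rewrite /= (_ : foldr _ _ _ = [seq (t.1, v ++ t.2) | t <- p]).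
  by rewrite /pscale -map_comp.
elim: v => [|l v IHv]; first by rewrite -[LHS]map_id; apply: eq_map => -[].
by rewrite /= IHv /prepend -map_comp.
Qed.

Lemma inJ_rel_mul r p : isRel q r -> inJ (pmul r p).
Proof.
move=> rel; elim: p => [|[x v] p IH].
  apply: (J_ext (inJ_nil (inJ_isRel rel))) => w; congr coef.
  by elim: (r) => //= a r' <-.
apply: (inJ_lin (x := x) (y := 1) (J_rel [::] v rel) IH) => w.
rewrite genE (coef_map (fun u => [::] ++ u ++ v)) !coef_rel_mul /peval.
rewrite mulr_sumr mul1r -big_split.
apply: eq_bigr => -[y u] _ /=.
have -> : coef (foldr (@prepend R disp I) ((x, v) :: p) u) w =
    (u ++ v == w)%:R * x + coef (foldr (@prepend R disp I) p u) w.
  elim: u w => [|l u IHu] w; first exact: coef_cons.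
  rewrite /= !coef_prepend; case: w => [|a w]; first by rewrite mul0r add0r.
  by rewrite IHu eqseq_cons -mulnb natrM; ring.
ring.
Qed.

(** For i < j the four relations, each multiplied by the slice of [t] at its leading letters, add up
    to the exchange of two neighbouring indices. *)
Lemma inJ_tens_swap ls1 ls2 i j (t : tensor) : (i < j)%O ->
  exists2 z, inJ z & forall w, coef z w =
    s * coef (tens (ls1 ++ [:: i, j & ls2]) (ins s (size ls1) (cap s (size ls1) t))) w
    - coef (tens (ls1 ++ [:: j, i & ls2]) t) w
    + q ^+ 2 * coef (tens (ls1 ++ [:: i, j & ls2]) t) w.
Proof.
move=> ij; elim: ls1 t => [|i' ls1 IH] t; last first.
  have [z0 J0 e0] := IH (slice false t); have [z1 J1 e1] := IH (slice true t).
  exists (prepend (X i') z0 ++ prepend (Y i') z1).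
    exact: J_add (inJ_prepend _ J0) (inJ_prepend _ J1).
  move=> w; rewrite /= !coef_cat !coef_prepend.
  by case: w => [|a w]; rewrite ?e0 ?e1; ring.
have rel r : r = rel_xx q i j \/ r = rel_yy q i j \/ r = rel_xjyi q i j \/
    r = rel_yjxi q i j -> isRel q r by right; exists i, j.
pose T a b := tens ls2 (slice b (slice a t)).
exists (pscale (-1) ((pmul (rel_xx q i j) (T false false) ++
    pmul (rel_yy q i j) (T true true)) ++ (pmul (rel_xjyi q i j) (T false true) ++
    pmul (rel_yjxi q i j) (T true false)))).
  by apply: J_scale; apply: J_add; apply: J_add;
    apply: inJ_rel_mul; apply: rel; tauto.
move=> w; rewrite coef_pscale (coef_cat (pmul (rel_xx q i j) _ ++ _)).
rewrite (coef_cat (pmul (rel_xx q i j) _)) (coef_cat (pmul (rel_xjyi q i j) _)).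
rewrite !coef_rel_mul !big_cons !big_nil /= !coef_cat !coef_prepend.
case: w => [|a [|b w]]; rewrite ?coef_cat ?coef_prepend;
  [by ring | by ring | rewrite !coef_tens /T /slice /=].
by case: (unzip1 w == ls2); rewrite /cup /= -?s2; field; rewrite ?s0 ?oner_neq0.
Qed.

(** This is the identity (ji) = -(ij) of H_I inside a longer word. *)
Lemma inJ_tens_flip ls1 ls2 i j (u : tensor) : (i < j)%O ->
  exists2 z, inJ z & forall w, coef z w =
    coef (tens (ls1 ++ [:: i, j & ls2]) (ins s (size ls1) u)) w
    + coef (tens (ls1 ++ [:: j, i & ls2]) (ins s (size ls1) u)) w.
Proof.
move=> ij; elim: ls1 u => [|i' ls1 IH] u; last first.
  have [z0 J0 e0] := IH (slice false u); have [z1 J1 e1] := IH (slice true u).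
  exists (prepend (X i') z0 ++ prepend (Y i') z1).
    exact: J_add (inJ_prepend _ J0) (inJ_prepend _ J1).
  move=> w; rewrite /= !coef_cat !coef_prepend.
  by case: w => [|a w]; rewrite ?e0 ?e1; ring.
exists (pscale s^-1 (pmul (rel_xjyi q i j) (tens ls2 u)) ++
    pscale (- s) (pmul (rel_yjxi q i j) (tens ls2 u))).
  by apply: J_add; apply: J_scale; apply: inJ_rel_mul; right; exists i, j; tauto.
move=> w; rewrite (coef_cat (pscale s^-1 _)) !coef_pscale !coef_rel_mul.
rewrite !big_cons !big_nil /= !coef_cat !coef_prepend.
case: w => [|a [|b w]]; rewrite ?coef_cat ?coef_prepend;
  [by ring | by ring | rewrite !coef_tens /slice /=].
by case: (unzip1 w == ls2); rewrite /cup /= -?s2; field; rewrite ?s0 ?oner_neq0.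
Qed.

(** Here (ii) is [s^-1] times the relation x_i y_i - q y_i x_i. *)
Lemma inJ_tens_diag ls1 ls2 i (u : tensor) :
  inJ (tens (ls1 ++ [:: i, i & ls2]) (ins s (size ls1) u)).
Proof.
elim: ls1 u => [|i' ls1 IH] u; last first.
  exact: J_add (inJ_prepend _ (IH (slice false u))) (inJ_prepend _ (IH (slice true u))).
have Jr : inJ (pmul (rel_xy q i) (tens ls2 u)).
  by apply: inJ_rel_mul; left; exists i.
apply: (J_ext (J_scale s^-1 Jr)) => w.
rewrite coef_pscale coef_rel_mul !big_cons !big_nil /= !coef_cat !coef_prepend.
case: w => [|a [|b w]]; rewrite ?coef_cat ?coef_prepend;
  [by ring | by ring | rewrite !coef_tens /slice /=].
by case: (unzip1 w == ls2); rewrite /cup /= -?s2; field; rewrite ?s0 ?oner_neq0.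
Qed.

(** * Reduction of nested cups to bracket products *)

Definition Gen_tensor n (t : tensor) := forall ls, size ls = n -> inGen (tens ls t).

(** The exchange expresses cup after cap at (i, j) through [t] itself at (i, j) and (j, i), which is
    why [Gen_tensor] ranges over all index sequences. The case i > j follows by antisymmetry of the
    cup, and for i = j the cup vanishes in H_I. *)
Lemma Gen_tensor_cap n k (t : tensor) : (k <= n)%N -> Gen_tensor n.+2 t ->
  Gen_tensor n.+2 (ins s k (cap s k t)).
Proof.
move=> kn Gt ls sls.
have [ls1 [i [j [ls2 [e k1]]]]] : exists ls1 i j ls2,
    ls = ls1 ++ [:: i, j & ls2] /\ size ls1 = k.
  have := cat_take_drop k ls; have: size (drop k ls) = (n - k).+2.
    by rewrite size_drop sls !subSn // leqW.
  case: (drop k ls) => [|i [|j ls2]] // _ <-.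
  exists (take k ls), i, j, ls2; split=> //.
  by rewrite size_takel // sls (leq_trans kn) // -addn2 leq_addr.
have lt ls2' i' j' : size (ls1 ++ [:: i', j' & ls2']) = n.+2 -> (i' < j')%O ->
    inGen (tens (ls1 ++ [:: i', j' & ls2']) (ins s k (cap s k t))).
  move=> sz ij; have [z Jz ez] := inJ_tens_swap ls1 ls2' t ij.
  have G1 : inGen (tens (ls1 ++ [:: j', i' & ls2']) t).
    by apply: Gt; rewrite -sz !size_cat.
  pose r := tens (ls1 ++ [:: j', i' & ls2']) t ++
    pscale (- q ^+ 2) (tens (ls1 ++ [:: i', j' & ls2']) t).
  have Gr : inGen r.
    apply: (inGen_lin (x := 1) (y := - q ^+ 2) G1 (Gt _ sz)) => w.
    by rewrite coef_cat coef_pscale mul1r.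
  (* Dividing by [s] solves the exchange relation for its cup-after-cap term. *)
  apply: (inGen_lin (x := s^-1) (y := s^-1) (inGen_inJ Jz) Gr) => w.
  by rewrite coef_cat !coef_pscale ez k1; field; rewrite s0.
rewrite e in sls *; case: (ltgtP i j) => ij.
- exact: lt.
- have [z Jz ez] := inJ_tens_flip ls1 ls2 (cap s k t) ij.
  have G1 : inGen (tens (ls1 ++ [:: j, i & ls2]) (ins s k (cap s k t))).
    by apply: lt => //; rewrite -sls !size_cat.
  apply: (inGen_lin (x := 1) (y := -1) (inGen_inJ Jz) G1) => w.
  by rewrite ez k1; ring.
- by rewrite ij -k1; apply/inGen_inJ/inJ_tens_diag.
Qed.

(* The zigzag relation turns a cup at positions k, k+1 into one at k+1, k+2. *)
Lemma Gen_tensor_ins n k (t : tensor) : (k <= n)%N -> Gen_tensor n t ->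
  Gen_tensor n.+2 (ins s k t).
Proof.
elim: k => [|k IH] kn Gt ls sls.
  (* A cup in front is left multiplication by the bracket of the first two indices. *)
  case: ls sls => [|i [|j ls]] //= [sls].
  apply: inGen_coef (inGen_bracket i j (Gt ls sls)) _ => w.
  rewrite coef_bracket_mul coef_cat !coef_prepend; case: w => [|a [|b w]];
    rewrite ?coef_cat ?coef_prepend; [by ring | by ring |].
  rewrite !coef_tens /slice /= /cup /=.
  by case: (unzip1 w == ls); ring.
have G := Gen_tensor_cap kn (IH (ltnW kn) Gt) sls.
apply: (inGen_lin (x := s^-1) (y := 0) G G) => w; rewrite mul0r addr0 !coef_tens.
case: eqP => [e|]; last by rewrite mulr0.
rewrite (@ins_fixed _ _ _ n (cap s k.+1 (ins s k t)) (fun b => s * t b + 0)).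
- by rewrite ins_lin ins_zero addr0 mulKf.
- by move=> b sb; rewrite cap_ins ?sb ?addr0.
- by rewrite size_map -sls -e size_map.
Qed.

Lemma Gen_tensor_cup_span n (t : tensor) : inJ [::] -> cup_span s 0 n t ->
  Gen_tensor n t.
Proof.
move=> J; move Ew: 0%N => w sp.
elim: sp Ew => {w n t} [w n|w|w n k t kn _ IH|w n x t u _ IHt _ IHu] e ls sls.
- by apply/inGen_inJ/(J_ext J) => w'; rewrite coef_tens coef_nil; case: ifP.
- move: sls; rewrite -e; case: ls => //= _.
  exact: inGen_pone.
- exact: Gen_tensor_ins (IH e) _ sls.
- apply: (inGen_lin (x := x) (y := 1) (IHt e ls sls) (IHu e ls sls)) => w'.
  by rewrite !coef_tens; case: ifP => _; ring.
Qed.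

(** * Lifting invariants to the free algebra *)

Hypothesis s_free : forall d : nat, (0 < d)%N -> s ^+ (4 * d) != 1.

Lemma inGen_highest p : inJ [::] -> (forall w, Kword s w * coef p w = coef p w) ->
  (forall w, coef (Dop false p) w = 0) -> inGen p.
Proof.
move=> J wt hw; have [U eU] := tens_comp_sum p.
apply: inGen_coef eU; apply: inGen_flatten => // r /mapP [ls _ ->].
apply: (@Gen_tensor_cup_span (size ls)) => //.
apply: (highest_cup_span s0 s_free) => [b sb|b|].
- exact: comp_size.
- by rewrite -comp_Dop /comp hw if_same.
- by apply: comp_weight => w; rewrite wt mul1r.
Qed.

(** Each unwanted weight [x] is removed by the operator (K - x)/(1 - x), which acts as the identity
    modulo J on elements that K fixes modulo J. *)
Lemma weight_zero_lift p (W : seq C) : inJ (psub (Kop s p) p) -> 1 \notin W ->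
  exists r, eqH p r /\
    forall w, coef r w != 0 -> coef p w != 0 /\ Kword s w \notin W.
Proof.
move=> JK; elim: W => [_|x W IH].
  exists p; split=> //; apply: eqH_coef JK _ => //.
rewrite inE negb_or => /andP [x1 /IH [r [pr supp]]].
exists (pscale (1 - x)^-1 (psub (Kop s r) (pscale x r))); split; last first.
  move=> w; rewrite coef_pscale coef_psub coef_pscale coef_Kop -mulrBl => nz.
  have wx : Kword s w != x.
    by apply: contraNneq nz => ->; rewrite subrr mul0r mulr0.
  have [|pw wW] := supp w; first by apply: contraNneq nz => ->; rewrite !mulr0.
  by rewrite in_cons negb_or wx.
have x1' : 1 - x != 0 by rewrite subr_eq0.
have JKpr : inJ (Kop s (psub p r)) by apply: inJ_Kop.
(* Modulo J, the new element is (K r - x r)/(1 - x) with r congruent to p and K p congruent to p. *)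
apply: (J_ext (J_add (J_scale (1 - x)^-1 (J_add JKpr (J_scale (-1) JK)))
  (J_scale (- x / (1 - x)) pr))) => w.
rewrite coef_cat !coef_pscale coef_cat !coef_pscale !coef_psub !coef_Kop.
rewrite !coef_psub !coef_pscale !coef_psub !coef_pscale !coef_Kop.
by field; rewrite x1'.
Qed.

(** Induction on the power of E that kills p in the free algebra. Since E p lies in J, so does F E
    p, and subtracting a multiple of it from p lowers that power by one. *)
Lemma inGen_nilpotent m p : (forall w, Kword s w * coef p w = coef p w) ->
  inJ (Dop false p) ->
  (forall ls b, iter m.+1 (raise s false) (comp p ls) b = 0) -> inGen p.
Proof.
elim: m p => [|m IH] p wt JE nil.
  apply: inGen_highest (inJ_nil JE) wt _ => w.
  have := nil (unzip1 w) (unzip2 w); rewrite /= -comp_Dop /comp !size_map eqxx.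
  by rewrite zip_unzip.
(* E p has K-eigenvalue [s ^+ 2] and E^(m+2) p = 0, so [iter_raise_commutator] gives E^(m+1) F E p =
   c E^(m+1) p. *)
pose c := qint s (s ^+ m.+1) * qint s (s ^+ m.+2).
have c0 : c != 0 by rewrite mulf_neq0 // qint_neq0.
pose FE := Dop true (Dop false p).
have JFE : inJ FE by apply: inJ_Dop.
pose r := p ++ pscale (- c^-1) FE.
have compE ls : comp FE ls = raise s true (raise s false (comp p ls)).
  by rewrite !comp_Dop.
have compr ls : comp r ls = fun b => - c^-1 * comp FE ls b + comp p ls b.
  apply/funext => b; rewrite /comp; case: ifP => _; last by rewrite mulr0 addr0.
  by rewrite coef_cat coef_pscale addrC.
have wE ls b : kw s b * raise s false (comp p ls) b
    = s ^+ 2 * raise s false (comp p ls) b.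
  rewrite (raise_weight s0 (d := false) (x := 1)) ?mul1r // => b'.
  by apply: comp_weight => w; rewrite wt mul1r.
have wFE ls b : kw s b * comp FE ls b = comp FE ls b.
  rewrite compE -[in RHS](mulVKf (kw_neq0 s0 b) (raise s true _ b)).
  rewrite (raise_weight s0 (d := true) (x := s ^- 2)) => [|b'].
    by rewrite mulVf ?expf_neq0 // mul1r.
  have [->|z] := eqVneq (raise s false (comp p ls) b') 0; first by rewrite !mulr0.
  by rewrite /= (mulIf z (wE ls b')).
have Gr : inGen r.
  apply: IH => [w||ls b].
  - rewrite coef_cat coef_pscale mulrDr wt mulrCA; congr (_ + _ * _).
    have := wFE (unzip1 w) (unzip2 w).
    by rewrite -Kword_unzip /comp !size_map eqxx zip_unzip.
  - rewrite lin_cat; apply: J_add JE _.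
    exact/inJ_Dop/J_scale.
  rewrite compr compE iter_raise_lin.
  rewrite (@iter_raise_commutator _ _ s0 s_free false (s ^+ 2)) ?expf_neq0 //;
    last exact: wE.
  rewrite -iterSr (_ : iter m.+2 _ _ = fun=> 0); last exact/funext/nil.
  by rewrite raise0 add0r -exprD -iterSr mulNr mulKf // addNr.
apply: (inGen_lin (x := 1) (y := c^-1) Gr (inGen_inJ JFE)) => w.
by rewrite coef_cat coef_pscale; ring.
Qed.


Lemma coef_mem p w : coef p w != 0 -> w \in [seq t.2 | t <- p].
Proof.
apply: contraR => wp; rewrite /coef big1_seq // => t /= tp.
by case: eqP => [e|]; [rewrite -e map_f in wp | rewrite mul0r].
Qed.

Lemma inGen_invariant k p : Defs.invariant q s k p -> inGen p.
Proof.
rewrite /Defs.invariant EopE => -[/eqH_inJ JE [_ [JK _]]].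
(* These are all the nontrivial weights that can occur in p; removing them leaves only words of
   weight 1. *)
pose W := [seq x <- [seq Kword s t.2 | t <- p] | x != 1].
have [|r [pr supp]] := weight_zero_lift (W := W) JK.
  by rewrite mem_filter eqxx.
apply: (inGen_eqH pr).
(* A word of length n contains at most n letters x to convert, so the longest word of r bounds the
   powers of E. *)
apply: (@inGen_nilpotent (\max_(t <- r) size t.2)) => [w||ls b].
- have [->|/supp [/coef_mem /mapP [t tp ->]]] := eqVneq (coef r w) 0.
    by rewrite mulr0.
  rewrite mem_filter (map_f (fun x : C * word => Kword s x.2)) // andbT negbK.
  by move=> /eqP ->; rewrite mul1r.
- apply: (inJ_lin (x := 1) (y := -1) JE (inJ_Dop false pr)) => w.
  by rewrite lin_cat coef_cat coef_lin_pscale; ring.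
have [le|lt] := leqP (size b) (\max_(t <- r) size t.2).
  by rewrite iter_raise_vanish // ltnS (leq_trans (count_size _ _)).
apply: (@iter_raise_size _ s false _ (size b)) => // b' sb'.
rewrite /comp; case: eqP => // sls; apply/eqP; rewrite -[_ == _]negbK.
apply: contraL lt => /coef_mem /mapP [t tr e]; rewrite -leqNgt -sb'.
by rewrite -(size2_zip (s := ls)) ?sls // e; apply: leq_bigmax_seq.
Qed.

(** * Invariance of bracket products *)

Lemma raise_comp_bracket_prod d ms ls b :
  raise s d (comp (bracket_prod s ms) ls) b = 0.
Proof.
elim: ms ls b => [|[i j] ms IH] ls b.
  case: b => // a b; apply: raise_vanish => -[|a' b'] // _ _.
  rewrite /comp; case: eqP; case: ls => //= i ls _.
  by rewrite coef_cons coef_nil mul0r addr0.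
have short : (size ls < 2)%N ->
    comp (bracket_prod s ((i, j) :: ms)) ls = fun=> 0.
  move=> sls; apply/funext => b'; rewrite /comp; case: eqP => // sb'.
  rewrite coef_bracket_mul !coef_prepend; case: ls sls sb' => [|i' [|]] //.
    by case: b' => // _ _; rewrite !mulr0 subrr.
  by case: b' => [|a []] // _ _; rewrite /= !coef_prepend !mulr0 subrr.
case: ls short => [|i' [|j' ls]] short; first by rewrite short // raise0.
  by rewrite short // raise0.
(* The first bracket inserts a cup in front when its indices match, and E and F commute with this
   insertion. *)
rewrite (_ : comp _ _ = fun b => ((i == i') && (j == j'))%:R *
    ins s 0 (comp (bracket_prod s ms) ls) b).
  rewrite raiseZ raise_ins // (_ : raise _ _ _ = fun=> 0) ?ins_zero ?mulr0 //.
  exact/funext/IH.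
apply/funext => -[|a [|c b']]; rewrite /comp /= ?mulr0 //.
rewrite !eqSS; case: eqP => _; last by rewrite !mulr0.
rewrite coef_bracket_mul !coef_prepend !xpair_eqE /cup.
by case: (i == i'); case: (j == j'); case: a; case: c => /=; ring.
Qed.

Lemma coef_Dop_bracket_prod d ms w : coef (Dop d (bracket_prod s ms)) w = 0.
Proof.
have := raise_comp_bracket_prod d ms (unzip1 w) (unzip2 w).
by rewrite -comp_Dop /comp !size_map eqxx zip_unzip.
Qed.

Lemma bracket_prod_weight ms w :
  Kword s w * coef (bracket_prod s ms) w = coef (bracket_prod s ms) w.
Proof.
elim: ms w => [|[i j] ms IH] w.
  rewrite coef_cons coef_nil; case: w => [|l w]; last by rewrite mul0r addr0 mulr0.
  by rewrite /Kword big_nil mul1r.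
rewrite coef_bracket_mul !coef_prepend.
case: w => [|[i' a] [|[j' c] w]]; rewrite ?coef_prepend; [by ring | by ring |].
rewrite -[in RHS](IH w) !Kword_cons !xpair_eqE.
by case: (i == i'); case: (j == j'); case: a; case: c;
  rewrite /Klet /=; field; rewrite ?s0 ?oner_neq0.
Qed.

Lemma bracket_prod_size ms w :
  s ^+ size w * coef (bracket_prod s ms) w
  = s ^+ (2 * size ms) * coef (bracket_prod s ms) w.
Proof.
elim: ms w => [|[i j] ms IH] w.
  by rewrite coef_cons coef_nil; case: w => [|l w] //; rewrite mul0r addr0 !mulr0.
rewrite coef_bracket_mul !coef_prepend.
case: w => [|a [|b w]]; rewrite ?coef_prepend; [by ring | by ring |].
rewrite mulnS exprD /= !exprS expr0 mulr1.
have e := IH w; set x := coef _ w in e *.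
rewrite (_ : s * (s * s ^+ size w) * _ = s * s * (s^-1 * ((X i == a)%:R * (Y j == b)%:R) -
  s * ((Y i == a)%:R * (X j == b)%:R)) * (s ^+ size w * x)); last by ring.
by rewrite e; ring.
Qed.

Lemma invariant_bracket_prod x (ms : seq (I * I)) : inJ [::] ->
  Defs.invariant q s (2 * size ms)%N (pscale x (bracket_prod s ms)).
Proof.
move=> J.
have D0 d : eqH (Dop d (pscale x (bracket_prod s ms))) [::].
  apply/eqH_inJ/(J_ext J) => w.
  by rewrite coef_nil coef_lin_pscale coef_Dop_bracket_prod mulr0.
rewrite /Defs.invariant EopE FopE; split; [exact: D0|split; [exact: D0|split]].
  apply: (eqH_coef J) => w.
  by rewrite coef_Kop coef_pscale mulrCA bracket_prod_weight.
apply: (eqH_coef J) => w.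
rewrite (coef_torus (fun w => s ^+ size w)) !coef_pscale mulrCA.
by rewrite bracket_prod_size mulrCA.
Qed.

End QuantumAlgebra.

Theorem theorem3p6 (R : realType) (q s : R[i]) :
  `|q| = 1 -> q != 1 -> q != -1 -> q != 'i -> q != - 'i ->
  s ^+ 2 = q ->
  (forall d : nat, (0 < d)%N -> q ^+ (2 * d) != 1) ->
  forall (disp : Order.disp_t) (I : orderType disp) (p : fpoly R I),
    inHInv q s p <-> inGenBrackets q s p.
Proof.
move=> q1 _ _ _ _ s2 q_free disp I p.
have s0 : s != 0.
  (* If [s] were 0, then q = s^2 would have absolute value 0 instead of 1. *)
  by apply: contraTneq (oner_neq0 R[i]) => z; rewrite -q1 -s2 z expr2 mul0r normr0 eqxx.
have s_free d : (0 < d)%N -> s ^+ (4 * d) != 1.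
  by rewrite -[4%N]/(2 * 2)%N -mulnA exprM s2; apply: q_free.
split=> [[ps [inv e]]|[ts e]].
  apply: (inGen_eqH e); apply: inGen_flatten => [|r]; first exact: inJ_nil e.
  by case/mapP => t /inv /(inGen_invariant s0 s2 s_free) ? ->.
(* Each term of the combination is itself invariant; its degree counts two letters per bracket. *)
exists [seq ((2 * size t.2)%N : int, pscale t.1 (bracket_prod s t.2)) | t <- ts].
split=> [_ /mapP [t _ ->]|]; first exact: invariant_bracket_prod (inJ_nil e).
by rewrite /unzip2 -map_comp.
Qed.
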